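(* Let $Y$ be a compact metrizable space. Then there exist a zero-dimensional compact metrizable space $X$ and a continuous map $f\colon X\to Y$ for which there exists a continuous map $s\colon Y\to I(X)$ such that $\mathrm{supp}(s(y))\subset f^{-1}(y)$ for every $y\in Y$.
   Context: For a compact Hausdorff space $X$, $C(X)$ is the Banach space of continuous real-valued functions on $X$ with the sup-norm; $c_X\in C(X)$ is the constant function with value $c\in\mathbb R$; $c\odot\varphi=c_X+\varphi$ for $c\in\mathbb R$, $\varphi\in C(X)$, and $\varphi\oplus\psi=\max\{\varphi,\psi\}$ (pointwise); for real numbers $a\odot b=a+b$, $a\oplus b=\max\{a,b\}$. An idempotent probability measure on $X$ is a functional $\mu\colon C(X)\to\mathbb R$ such that $\mu(c_X)=c$, $\mu(c\odot\varphi)=c\odot\mu(\varphi)$ and $\mu(\varphi\oplus\psi)=\mu(\varphi)\oplus\mu(\psi)$ for all $c\in\mathbb R$, $\varphi,\psi\in C(X)$. $I(X)$ is the set of all idempotent probability measures on $X$ with the weak* topology, whose base consists of the sets $\{\nu\in I(X)\mid |\mu(\varphi_i)-\nu(\varphi_i)|<\varepsilon,\ i=1,\dots,n\}$, where $\mu\in I(X)$, $\varphi_1,\dots,\varphi_n\in C(X)$, $\varepsilon>0$. For a continuous map $f\colon X\to Y$ of compact Hausdorff spaces, $I(f)\colon I(X)\to I(Y)$ is defined by $I(f)(\mu)(\varphi)=\mu(\varphi\circ f)$, $\varphi\in C(Y)$. For a closed subset $A\subset X$ with inclusion $i\colon A\to X$, $I(A)$ is identified with the subspace $I(i)(I(A))$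 of $I(X)$. The support of $\mu\in I(X)$ is $\mathrm{supp}(\mu)=\bigcap\{A\mid A\text{ is a closed subset of }X\text{ and }\mu\in I(A)\}$. *)

(* Defs.v *)
From HB Require Import structures.
From mathcomp Require Import all_boot all_order all_algebra.
From mathcomp Require Import boolp classical_sets functions reals topology.
From mathcomp Require Import normedtype.

Set Implicit Arguments.
Unset Strict Implicit.
Unset Printing Implicit Defensive.
Import Order.TTheory GRing.Theory Num.Theory.
Import numFieldNormedType.Exports.

Local Open Scope classical_set_scope.
Local Open Scope ring_scope.

Definition metrizable (R : realType) (T : topologicalType) : Prop :=
  exists d : T -> T -> R,
    [/\ forall x y, 0 <= d x y,
        forall x y, d x y = 0 <-> x = y,
        forall x y, d x y = d y x,
        forall x y z, d x z <= d x y + d y z &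
        forall (x : T) (U : set T),
          nbhs x U <-> exists2 e, 0 < e & [set y | d x y < e] `<=` U].

(* MathComp-Analysis' [zero_dimensional] asks that points be separated by
   clopen sets; on compact Hausdorff spaces this is the existence of a base
   of clopen sets. *)
Lemma zero_dimensional_clopen_base (T : topologicalType) :
  hausdorff_space T -> compact [set: T] ->
  zero_dimensional T <->
  forall (x : T) (U : set T), nbhs x U ->
    exists V : set T, [/\ clopen V, V x & V `<=` U].
Proof.
move=> hT cT; split=> [zT x U Ux | bT x y xy].
  have [V [Vx cV] VU] := zero_dimensional_cvg hT zT cT Ux.
  by exists V.
have := hausdorff_accessible hT; move=> /(_ _ _ xy)[U [oU]].
rewrite !inE => xU yU.
have [V [cV Vx VU]] := bT x U (open_nbhs_nbhs (conj oU xU)).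
by exists V; split => // /VU.
Qed.

Section IdempotentMeasures.
Variable R : realType.
Implicit Types X Y : topologicalType.

Local Notation C X := (continuousType X R).

Lemma shift_continuous X (c : R) (phi : C X) :
  continuous (fun x => c + phi x).
Proof. by move=> x; apply: continuousD; [exact: cst_continuous | exact: cts_fun]. Qed.

Definition cshift X (c : R) (phi : C X) : C X := mkcts (@shift_continuous X c phi).

Lemma max_continuous X (phi psi : C X) :
  continuous (fun x => Num.max (phi x) (psi x)).
Proof. by move=> x; apply: continuous_max; exact: cts_fun. Qed.

Definition cmax X (phi psi : C X) : C X := mkcts (@max_continuous X phi psi).

Definition idempotent_measures X : set {ptws C X -> R} :=
  [set mu | [/\ forall c : R, mu (cst c : C X) = c,
                forall (c : R) (phi : C X), mu (cshift c phi) = c + mu phi &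
                forall phi psi : C X,
                  mu (cmax phi psi) = Num.max (mu phi) (mu psi)]].

(* The weak* topology is that of pointwise convergence on C(X); see
   [nbhs_idemP] below for its base. *)
Definition idem X : topologicalType := set_type (@idempotent_measures X).

Definition idem_eval X (mu : idem X) : C X -> R := set_val mu.

Lemma nbhs_idemP X (mu : idem X) (U : set (idem X)) :
  nbhs mu U <->
  exists (s : seq (C X)) (e : R), 0 < e /\
    [set nu : idem X | forall phi, phi \in s ->
       `|idem_eval mu phi - idem_eval nu phi| < e] `<=` U.
Proof.
split=> [|[s [e [e0 sU]]]].
  pose F : set_system (idem X) := [set V | exists (s : seq (C X)) (e : R),
    0 < e /\ [set nu : idem X | forall phi, phi \in s ->
       `|idem_eval mu phi - idem_eval nu phi| < e] `<=` V].
  have FF : Filter F.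
    split.
    - by exists [::], 1.
    - move=> A B [s [e [e0 sA]]] [t [d [d0 tB]]].
      exists (s ++ t), (Num.min e d); split; first by rewrite lt_min e0.
      move=> nu nuP; split; [apply: sA | apply: tB] => phi phis.
      + have /nuP : phi \in s ++ t by rewrite mem_cat phis.
        by rewrite lt_min => /andP[].
      + have /nuP : phi \in s ++ t by rewrite mem_cat phis orbT.
        by rewrite lt_min => /andP[].
    - by move=> A B AB [s [e [e0 sA]]]; exists s, e; split=> // nu /sA /AB.
  suff : F --> mu by apply.
  have FFv : (set_val : idem X -> {ptws C X -> R}) @ F --> set_val mu.
    apply/cvg_sup => phi A [_ [[B oB <-] Bmu] BA].
    have /nbhs_ballP[e e0 eB] : nbhs (set_val mu phi : R) B.
      exact: open_nbhs_nbhs.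
    exists [:: phi], e; split=> // nu /(_ phi (mem_head _ _)) nuP.
    by apply/BA/eB.
  move=> A [_ [[B oB <-] Bmu] BA].
  apply: (@filterS _ F FF _ _ BA); apply: FFv; exact: open_nbhs_nbhs.
have FN : Filter (nbhs mu) by exact: nbhs_filter.
apply: (@filterS _ _ FN _ _ sU) => {sU}.
elim: s => [|phi s IH].
  by apply: (@filterS _ _ FN setT) => //; exact: (@filterT _ _ FN).
have ev : continuous (fun nu : idem X => idem_eval nu phi).
  move=> nu.
  apply: (@continuous_comp (idem X) {ptws C X -> R} R set_val (@^~ phi)).
    exact: (@initial_continuous (idem X) {ptws C X -> R} set_val nu).
  exact: (@proj_continuous (C X) (fun=> R) phi).
have : nbhs mu [set nu : idem X | `|idem_eval mu phi - idem_eval nu phi| < e].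
  exact: (ev mu _ (nbhsx_ballx (idem_eval mu phi : R) e e0)).
move=> H; apply: (@filterS _ _ FN _ _ _ (@filterI _ _ FN _ _ H IH)).
move=> nu [nu1 nu2] psi.
by rewrite inE => /orP[/eqP -> //|/nu2].
Qed.

Definition comp_cts X Y (phi : C Y) (f : continuousType X Y) : C X := phi \o f.

Lemma idem_map_subproof X Y (f : continuousType X Y) (mu : idem X) :
  idempotent_measures
    (fun phi : C Y => idem_eval mu (comp_cts phi f)).
Proof.
have [mu1 mu2 mu3] := set_valP mu; split=> [c|c phi|phi psi].
- rewrite -[RHS](mu1 c); congr (set_val mu _); exact/continuousEP.
- rewrite -[RHS]mu2; congr (set_val mu _); exact/continuousEP.
- rewrite -[RHS]mu3; congr (set_val mu _); exact/continuousEP.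
Qed.

Definition idem_map X Y (f : continuousType X Y) (mu : idem X) : idem Y :=
  exist (fun nu => nu \in @idempotent_measures Y) _
    (mem_set (idem_map_subproof f mu)).

Lemma incl_continuous X (A : set X) : continuous (set_val : A -> X).
Proof. exact: initial_continuous. Qed.

Definition incl X (A : set X) : continuousType A X :=
  mkcts (@incl_continuous X A).

(* A closed [A] is a set and [idem A] a separate type, so "mu lies in I(A)" is
   read as "mu is in the image of I(A) under I(inclusion)". *)
Definition supp X (mu : idem X) : set X :=
  \bigcap_(A in [set A : set X | closed A /\ range (idem_map (incl A)) mu]) A.

End IdempotentMeasures.

(* Main.v *)
Require Import Defs.
From mathcomp Require Import all_boot all_order all_algebra.
From mathcomp Require Import boolp classical_sets functions reals topology.
From mathcomp Require Import normedtype cantor lra.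

Import Order.TTheory GRing.Theory Num.Theory.
Import numFieldNormedType.Exports.
Local Open Scope classical_set_scope.

(** Choose continuous functions [u n : Y -> R] such that any two distinct
points [y], [y'] satisfy [u n y < -1] and [1 < u n y'] for some [n]
([separating_sequence]).  Each [u n] offers two overlapping closed halves of
[Y], the sets [-1 <= u n] and [u n <= 1].  Let [X] consist of the pairs
[(k, y)] where [k] is a bit sequence that selects, for every [n], a half
containing [y].  By the choice of the [u n], the bits determine the point, so
the bits form an injective family of continuous two-valued functions on the
compact space [X].  Such a family makes [X] zero-dimensional and metrizable
([coded_zero_dimensional], [coded_metrizable]).  The map [f] is the second
projection.

The measure [s y] is a supremum of [phi x - t] over pairs [(x, t)] of a point
[x] of the fibre of [y] and a penalty [t >= 0], so that it is idempotent
([weighted_sup_idempotent]) and supported in the fibre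
([weighted_idem_supp]).  Writing [v] for [u n y] or [- u n y], according to
the [n]-th bit of [x], the pair is allowed when [1 <= (1 + t) * (1 + v)] for
all [n], that is, when [v >= - t / (1 + t)].  So the penalty is [0] as long as
the selected half is [0 <= v], and it tends to infinity when [v] decreases to
[-1], before the half [-1 <= v] is lost.

Continuity of [s] rests on two facts.  A bit with [0 <= v] is free of charge,
and one of the two bits always has this property; hence any finite prefix of
bits that is affordable at [y] extends to a point of the fibre of [y] without
raising the penalty ([fibre_weights_graft]).  And a continuous function on [X]
depends, up to a small error, on a finite prefix only ([prefix_modulus]).
When [y'] is close to [y], the finitely many numbers [u n y'] of the prefix
are close to [u n y]; penalties that are not larger than twice the bound of
[phi] then change little, and larger ones cannot contribute to the supremum
([weighted_sup_close]). *)

(** * Compactness of subspaces, metrizable spaces *)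

Lemma compact_set_type (T : topologicalType) (A : set T) :
  compact A -> compact [set: A].
Proof.
move=> /compact_near_coveringP/near_covering_withinP cA.
apply/compact_near_coveringP => J F P FF AP.
pose P' i x := forall a : A, set_val a = x -> P i a.
apply: (filterS _ (cA J F P' FF _)).
  by move=> i iP a _; apply: iP (set_valP a) _ erefl.
move=> x Ax; have [[U V] /= [[_ [[B oB <-] /= Bx] BU] FV] UVP] :=
    AP (exist _ x (mem_set Ax)) I.
exists (B, V) => [|[y i] /= [By Vi] Ay a ay].
  by split => //; apply: open_nbhs_nbhs.
by apply: (UVP (a, i)); split => //; apply: BU; rewrite /= ay.
Qed.

Lemma metrizable_hausdorff (R : realType) (T : topologicalType) :
  metrizable R T -> hausdorff_space T.
Proof.
move=> [d [d_ge0 d0 d_sym d_tri dN]] x y xy.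
apply/d0/eqP; rewrite eq_le d_ge0 andbT.
apply/ler_addgt0Pr => e e0; rewrite add0r.
have e20 : (0 < e / 2)%R by rewrite divr_gt0.
have nb z : nbhs z [set w | d z w < e / 2]%R by apply/dN; exists (e / 2)%R.
have [z [/= xz yz]] := xy _ _ (nb x) (nb y).
have := d_tri x z y; rewrite (d_sym z y); lra.
Qed.

(** * Compact spaces with an injective binary code *)

Section CodedSpace.
Set Implicit Arguments.
Unset Strict Implicit.
Unset Printing Implicit Defensive.
Local Open Scope ring_scope.
Variables (R : realType) (T : topologicalType) (b : T -> nat -> bool).
Hypothesis compactT : compact [set: T].
Hypothesis b_cont : forall n, continuous (fun x => b x n).
Hypothesis b_inj : injective b.

Let agree N x y := forall n, (n < N)%N -> b x n = b y n.

Lemma nbhs_bit n x : nbhs x [set y | b x n = b y n].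
Proof.
have /(_ [set c | b x n = c]) := @b_cont n x; apply.
by apply/principal_filterP.
Qed.

Lemma nbhs_agree N x : nbhs x (agree N x).
Proof.
elim: N => [|N IH]; first by apply: filterS filterT => y _ n.
apply: filterS (filterI IH (nbhs_bit N x)) => y [xyN xyS] n.
by rewrite ltnS leq_eqVlt => /orP[/eqP ->//|/xyN].
Qed.

Lemma first_difference x y : x <> y ->
  exists m, agree m x y /\ b x m != b y m.
Proof.
move=> xy; have exn : exists n, b x n != b y n.
  apply: contrapT => H; apply: xy; apply: b_inj; apply/funext => n.
  by apply/eqP; apply: contrapT => /negP xyn; apply: H; exists n.
exists (ex_minn exn); case: ex_minnP => m xym mmin; split => // n nm.
by apply/eqP; apply: contraTT nm => /mmin; rewrite -leqNgt.
Qed.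

(** The cylinders around [x] shrink to [x] since the code is injective; by
compactness of [T] they get inside every neighbourhood of [x]. *)
Lemma agree_base x U : nbhs x U -> exists N, agree N x `<=` U.
Proof.
move=> xU; have /compact_near_coveringP cT := compactT.
have [|N _ NU] := cT nat \oo (fun N y => agree N x y -> U y) _ _; last first.
  exists N => y; apply: NU => //=.
move=> y _; have [<-|xy] := pselect (x = y).
  exists (U, setT); first by split => //; exact: filterT.
  by move=> [z N] /= [Uz _] _.
have [n [_ xyn]] := first_difference xy.
exists ([set z | b y n = b z n], [set N | (n < N)%N]).
  split; first exact: nbhs_bit.
  by exists n.+1.
move=> [z N] /= [yzn nN] /(_ n nN) E.
by move: xyn; rewrite E yzn eqxx.
Qed.

Lemma coded_zero_dimensional : zero_dimensional T.
Proof.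
move=> x y xy.
have [n [_ /eqP xyn]] := first_difference (elimN eqP xy).
exists [set z | b x n = b z n]; split => //; split.
  rewrite openE => z /= ->; exact: nbhs_bit.
rewrite closedE => z /= zn; apply: contrapT => xzn; apply: zn.
by apply: filterS (nbhs_bit n z) => w /= zw xw; apply: xzn; rewrite zw.
Qed.

(** The metric is [1 / (m + 1)], where [m] is the first index at which the codes
differ.  Its closed balls of radius [1 / (N + 1)] are the cylinders of length
[N], whence the ultrametric inequality. *)
Lemma coded_metrizable : metrizable R T.
Proof.
pose m x y := xget 0%N [set m | agree m x y /\ b x m != b y m].
have mP x y : x <> y -> agree (m x y) x y /\ b x (m x y) != b y (m x y).
  move=> /first_difference[k kP].
  exact: (@xgetI _ 0%N [set m | agree m x y /\ b x m != b y m] k kP).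
pose d x y : R := if x == y then 0 else (m x y).+1%:R^-1.
have d_ge0 x y : 0 <= d x y by rewrite /d; case: eqP => // _; rewrite invr_ge0.
have dP x y N : d x y <= N.+1%:R^-1 <-> agree N x y.
  rewrite /d; case: eqP => [-> //|/mP[xym dxy]].
    by split => // _; rewrite invr_ge0.
  rewrite lef_pV2 ?posrE ?ltr0n// ler_nat ltnS; split => [Nm n nN|xyN].
    by apply: xym; exact: leq_trans Nm.
  by rewrite leqNgt; apply: contraNN dxy => /xyN ->.
have agree_sym N x y : agree N x y -> agree N y x by move=> H n /H.
have d_dich x y : d x y = 0 \/ exists N, d x y = N.+1%:R^-1.
  by rewrite /d; case: eqP => _; [left|right; exists (m x y)].
have le_d x y x' y' : (forall N, agree N x y -> agree N x' y') ->
    d x' y' <= d x y.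
  move=> H; have [|[N dE]] := d_dich x y; last first.
    by rewrite dE; apply/dP/H/dP; rewrite dE.
  rewrite /d; case: (x =P y) => [xy _|_ /eqP]; last first.
    by rewrite invr_eq0 pnatr_eq0.
  case: eqP => // /mP[_ /eqP[]]; apply: (H (m x' y').+1) => //.
  by rewrite xy.
exists d; split=> //.
- move=> x y; rewrite /d; case: eqP => [->//|xy]; split => // /eqP.
  by rewrite invr_eq0 pnatr_eq0.
- by move=> x y; apply/eqP; rewrite eq_le !le_d// => N; exact: agree_sym.
- move=> x y z; have [xy|/ltW yx] := leP (d x y) (d y z).
    apply: (@le_trans _ _ (d y z)); last by rewrite lerDr.
    apply: le_d => N yz n nN.
    have /dP/(_ _ nN) -> : d x y <= N.+1%:R^-1.
      by apply: le_trans xy _; apply/dP.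
    exact: yz.
  apply: (@le_trans _ _ (d x y)); last by rewrite lerDl.
  apply: le_d => N xy n nN; rewrite xy//.
  by have /dP/(_ _ nN) : d y z <= N.+1%:R^-1 by apply: le_trans yx _; apply/dP.
- move=> x U; split=> [xU|[e e0 eU]].
    have [N NU] := agree_base xU.
    exists N.+1%:R^-1; first by rewrite invr_gt0.
    by move=> y /= /ltW/dP/NU.
  have [N Ne] := ltr_add_invr e0; rewrite add0r in Ne.
  apply: filterS (nbhs_agree N x) => y /dP xy; apply: eU => /=.
  exact: le_lt_trans Ne.
Qed.

(** By continuity, [phi] varies little on some cylinder around each point;
compactness bounds the lengths of these cylinders. *)
Lemma prefix_modulus (phi : T -> R) (e : R) : continuous phi -> 0 < e ->
  exists N, forall x y, agree N x y -> `|phi x - phi y| < e.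
Proof.
move=> cphi e0; have /compact_near_coveringP cT := compactT.
have [|N _ NP] := cT nat \oo
    (fun N x => forall y, agree N x y -> `|phi x - phi y| < e) _ _; last first.
  by exists N => x y; apply: NP => //=.
move=> x _; have e20 : 0 < e / 2 by rewrite divr_gt0.
have [N NU] := agree_base (cphi x _ (nbhsx_ballx (phi x : R) _ e20)).
exists (agree N x, [set M | (N <= M)%N]).
  by split; [exact: nbhs_agree | exists N].
move=> [z M] /= [xz NM] y zy.
have xy : agree N x y by move=> n nN; rewrite xz// zy//; exact: leq_trans NM.
have /= xz' := NU _ xz; have /= xy' := NU _ xy.
rewrite (splitr e); apply: le_lt_trans (ler_distD (phi x) _ _) _.
by apply: ltrD => //; rewrite distrC.
Qed.

End CodedSpace.

(** * Idempotent measures given by penalties *)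

Section WeightedSup.
Set Implicit Arguments.
Unset Strict Implicit.
Unset Printing Implicit Defensive.
Local Open Scope ring_scope.
Variables (R : realType) (X : topologicalType).

Lemma compact_bounded_fun (phi : X -> R) : compact [set: X] -> continuous phi ->
  exists B, forall x, `|phi x| <= B.
Proof.
move=> cX cphi.
have /compact_bounded[M [_ MP]] : compact (phi @` [set: X]).
  apply: continuous_compact => //; exact: continuous_subspaceT.
by exists (M + 1) => x; apply: (MP (M + 1)); [rewrite ltrDl | exists x].
Qed.

Variable W : set (X * R).
Hypothesis compactX : compact [set: X].
Hypothesis W_ge0 : forall w, W w -> 0 <= w.2.

(** This is the idempotent integral of [phi] for the density that is, at [x],
minus the infimum of the penalties [t] with [W (x, t)], hence minus infinity
where there is no penalty.  Listing penalties instead of a density keeps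
infinite values out. *)
Definition weighted_sup (phi : X -> R) : R := sup [set phi w.1 - w.2 | w in W].

Lemma weighted_sup_ub (phi : X -> R) w : continuous phi -> W w ->
  phi w.1 - w.2 <= weighted_sup phi.
Proof.
move=> cphi Ww; apply: ub_le_sup; last by exists w.
have [B BP] := compact_bounded_fun compactX cphi.
exists B => _ [v Wv <-]; have := BP v.1; have := W_ge0 Wv.
by rewrite ler_norml => ? /andP[_]; lra.
Qed.

Hypothesis W_top : exists x, W (x, 0).

Lemma weighted_sup_le (phi : X -> R) r :
  (forall w, W w -> phi w.1 - w.2 <= r) -> weighted_sup phi <= r.
Proof.
move=> H; apply: ge_sup; last by move=> _ [w Ww <-]; exact: H.
by have [x Wx] := W_top; exists (phi x - 0), (x, 0).
Qed.

Lemma weighted_sup_idempotent :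
  @idempotent_measures R X (fun phi => weighted_sup phi).
Proof.
have [x0 Wx0] := W_top; split=> [c|c phi|phi psi].
- apply/eqP; rewrite eq_le; apply/andP; split.
    by apply: weighted_sup_le => w /W_ge0 /=; rewrite lerBlDr lerDl.
  have /= := weighted_sup_ub (@cst_continuous _ _ c) Wx0.
  by rewrite subr0.
- apply/eqP; rewrite eq_le; apply/andP; split.
    apply: weighted_sup_le => w Ww /=; rewrite -addrA lerD2l.
    by apply: weighted_sup_ub => //; exact: cts_fun.
  rewrite -lerBrDl; apply: weighted_sup_le => w Ww; rewrite lerBrDl addrA.
  exact: (weighted_sup_ub (@cts_fun _ _ (cshift c phi)) Ww).
- apply/eqP; rewrite eq_le ge_max; apply/andP; split; last first.
    apply/andP; split; apply: weighted_sup_le => w Ww;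
      apply: (le_trans _ (weighted_sup_ub (@cts_fun _ _ (cmax phi psi)) Ww));
      by rewrite /= lerD2r le_max lexx ?orbT.
  apply: weighted_sup_le => w Ww /=; rewrite addr_maxl ge_max !le_max.
  have := weighted_sup_ub (@cts_fun _ _ phi) Ww.
  have := weighted_sup_ub (@cts_fun _ _ psi) Ww.
  by move=> -> ->; rewrite orbT.
Qed.

Definition weighted_idem : idem R X :=
  exist (fun mu => mu \in @idempotent_measures R X) _
    (mem_set weighted_sup_idempotent).

End WeightedSup.

Section Support.
Set Implicit Arguments.
Unset Strict Implicit.
Unset Printing Implicit Defensive.
Local Open Scope ring_scope.
Variable R : realType.

(** The restriction of the penalties to the subspace [A] defines an idempotent
measure on [A], whose image under the inclusion is the given one. *)
Lemma weighted_idem_supp (X : topologicalType) (W : set (X * R))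
    (cX : compact [set: X]) (W0 : forall w, W w -> 0 <= w.2)
    (Wt : exists x, W (x, 0)) (A : set X) :
  closed A -> (forall w, W w -> A w.1) -> supp (weighted_idem cX W0 Wt) `<=` A.
Proof.
move=> clA WA x; apply; split => //=.
pose WA' : set (A * R) := [set w | W (set_val w.1, w.2)].
have cA : compact [set: A].
  exact: compact_set_type (subclosed_compact clA cX _).
have WA0 w : WA' w -> 0 <= w.2 by move=> /W0.
have WAt : exists a, WA' (a, 0).
  have [x0 Wx0] := Wt; exists (exist _ x0 (mem_set (WA _ Wx0))) => //.
exists (weighted_idem cA WA0 WAt) => //.
apply: eq_exist; apply/funext => phi /=.
rewrite /weighted_sup; congr sup.
apply/seteqP; split => [_ [w Ww <-]|_ [w Ww <-]] /=.
  by exists (set_val w.1, w.2).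
exists (exist _ w.1 (mem_set (WA _ Ww)), w.2) => //.
by rewrite /WA' /=; case: w Ww.
Qed.

End Support.

(** * Separating functions on a compact metrizable space *)

Section Separating.
Set Implicit Arguments.
Unset Strict Implicit.
Unset Printing Implicit Defensive.
Local Open Scope ring_scope.
Variables (R : realType) (Y : topologicalType).

(** The functions are [(m + 1) * d p - 3], where [p] runs through a finite net of
mesh [2 / (m + 1)].  If [d y y' > 6 / (m + 1)] and [p] is a point of the net
near [y], then [d p y < 2 / (m + 1)] while [d p y' > 4 / (m + 1)]. *)
Lemma separating_sequence : compact [set: Y] -> metrizable R Y ->
  exists u : nat -> Y -> R, (forall n, continuous (u n)) /\
    forall y y', y <> y' -> exists n, u n y < -1 /\ 1 < u n y'.
Proof.
move=> cY [d [d_ge0 d0 d_sym d_tri dN]].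
have d_cont p : continuous (d p).
  move=> y A /nbhs_ballP[e /= e0 eA]; apply/dN; exists e => // z /= yz.
  apply: eA => /=; rewrite /ball /= ltr_norml.
  have := d_tri p y z; have := d_tri p z y; rewrite (d_sym z y) => ? ?.
  by apply/andP; split; lra.
have net m : exists s : seq Y,
    forall y, exists2 p, p \in s & d p y < 2 / m.+1%:R.
  have m0 : 0 < 2 / m.+1%:R :> R by rewrite divr_gt0.
  (* For the filter generated by the sets of all lists containing a given list,
     eventually means for every large enough finite set of centres. *)
  pose F := filter_from [set: seq Y]
    (fun s => [set t : seq Y | {subset s <= t}]).
  have FF : Filter F.
    apply: filter_from_filter; first by exists [::].
    move=> s t _ _; exists (s ++ t) => // r /= str.
    by split=> p pst; apply: str; rewrite mem_cat pst ?orbT.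
  have /compact_near_coveringP cov := cY.
  have [|s _ sP] := cov (seq Y) F
      (fun s y => exists2 p, p \in s & d p y < 2 / m.+1%:R) FF _; last first.
    by exists s => y; exact: (sP s (fun _ => id) y I).
  move=> y _; exists ([set z | d y z < 2 / m.+1%:R], [set s : seq Y | y \in s]).
    split; first by apply/dN; exists (2 / m.+1%:R).
    by exists [:: y] => // s; apply; rewrite mem_head.
  by move=> [z s] /= [yz ys]; exists y.
have [s sP] := choice net.
pose F m : seq (Y -> R) := [seq (fun y => m.+1%:R * d p y - 3) | p <- s m].
(* [n] encodes a pair of a mesh and a position in its net; beyond the end of the
   net the function is [0], so that every [u n] is continuous. *)
pose u n := let ij := odflt (0, 0)%N (unpickle n) in nth (cst 0) (F ij.1) ij.2.
exists u; split=> [n|y y' yy'].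
  rewrite /u /F; set ij := odflt _ _.
  have [ijs|ijs] := ltnP ij.2 (size (s ij.1)); last first.
    by rewrite nth_default ?size_map//; exact: cst_continuous.
  case: (s ij.1) ijs => // p0 s' ijs; rewrite (nth_map p0)//.
  move=> y; apply: cvgB; last exact: cvg_cst.
  by apply: cvgM; [exact: cvg_cst | exact: d_cont].
have dyy' : 0 < d y y'.
  by rewrite lt_neqAle d_ge0 andbT eq_sym; apply/eqP => /d0.
have d60 : 0 < d y y' / 6 by rewrite divr_gt0.
have [m] := ltr_add_invr d60; rewrite add0r => mP.
have [p ps py] := sP m y.
exists (pickle (m, index p (s m))); rewrite /u pickleK /=.
rewrite (nth_map p) ?index_mem// nth_index//.
move: mP py; rewrite -[X in X < _]div1r ltr_pdivrMr ?ltr_pdivlMr// => mP py.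
have : m.+1%:R * d y y' <= m.+1%:R * (d p y + d p y').
  by rewrite ler_pM2l// -(d_sym y p).
by move=> ?; split; lra.
Qed.
End Separating.

(** * Itineraries and the measures on their fibres *)

Section Construction.
Set Implicit Arguments.
Unset Strict Implicit.
Unset Printing Implicit Defensive.
Local Open Scope ring_scope.
Variables (R : realType) (Y : topologicalType) (u : nat -> Y -> R).
Hypothesis compactY : compact [set: Y].
Hypothesis u_cont : forall n, continuous (u n).
Hypothesis u_sep : forall y y', y <> y' -> exists n, u n y < -1 /\ 1 < u n y'.

(** Bit [false] selects the half [-1 <= u n], bit [true] the half [u n <= 1]. *)
Definition itinerary_set : set (cantor_space * Y) :=
  [set x : cantor_space * Y | forall n, -1 <= (-1) ^+ x.1 n * u n x.2].

Notation X := (set_type itinerary_set).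
Notation code x := (set_val (x : X)).1.
Notation base x := (set_val (x : X)).2.

Lemma bit_continuous n : continuous (fun x : cantor_space * Y => x.1 n).
Proof.
move=> x; apply: (@continuous_comp _ cantor_space bool fst (@^~ n)).
  exact: cvg_fst.
exact: (@proj_continuous nat (fun=> bool) n).
Qed.

Lemma itinerary_set_closed : closed itinerary_set.
Proof.
have -> : itinerary_set =
    \bigcap_n [set x : cantor_space * Y | -1 <= (-1) ^+ x.1 n * u n x.2].
  by apply/seteqP; split=> x /= H n; [move=> _; exact: H | exact: (H n I)].
apply: closed_bigI => n _.
apply: (@preimage_closed _ R
  (fun x : cantor_space * Y => (-1) ^+ x.1 n * u n x.2)
  [set r | -1 <= r]); last exact: closed_ge.
move=> x _; apply: cvgM.
  apply: (@continuous_comp _ bool R (fun x : cantor_space * Y => x.1 n)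
    (fun b : bool => (-1) ^+ b)); first exact: bit_continuous.
  by move=> A /nbhs_singleton H; apply/principal_filterP.
apply: (@continuous_comp _ Y R snd (u n)); first exact: cvg_snd.
exact: u_cont.
Qed.

Lemma compact_itineraries : compact [set: X].
Proof.
apply: compact_set_type.
apply: (subclosed_compact itinerary_set_closed) (@subsetT _ _).
by have := compact_setX cantor_space_compact compactY; rewrite setXTT.
Qed.

Lemma code_bit_continuous n : continuous (fun x : X => code x n).
Proof.
move=> x; apply: (@continuous_comp X (cantor_space * Y)%type bool set_val
  (fun x => x.1 n)).
  exact: initial_continuous.
exact: bit_continuous.
Qed.

Lemma base_continuous : continuous (fun x : X => base x).
Proof.
move=> x; apply: (@continuous_comp X (cantor_space * Y)%type Y set_val snd).
  exact: initial_continuous.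
exact: cvg_snd.
Qed.

Lemma code_inj : injective (fun x : X => (code x : nat -> bool)).
Proof.
move=> [[k y] Kx] [[k' y'] Kx'] /= E; apply: eq_exist.
move: E Kx => /= -> /set_mem Ky; move: Kx' => /set_mem Ky'.
congr (_, _); apply: contrapT => /u_sep[n [uy uy']].
have := Ky n; have := Ky' n => /=.
by case: (k' n); rewrite ?expr1 ?expr0; lra.
Qed.

(** With [v] for the signed value of [u n y], a bit requires the penalty
[1 / (1 + v) - 1], which is at most [0] for [0 <= v] and tends to infinity
when [v] decreases to [-1]: a half of [Y] is abandoned continuously. *)
Definition fibre_weights (y : Y) : set (X * R) := [set w : X * R |
  [/\ base w.1 = y, 0 <= w.2 &
      forall n, 1 <= (1 + w.2) * (1 + (-1) ^+ code w.1 n * u n y)]].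

Lemma sign_choice (r : R) : 0 <= (-1) ^+ (r < 0)%R * r.
Proof. by case: ltP => r0; rewrite ?expr1 ?expr0; lra. Qed.

Lemma fibre_weights_ge0 y w : fibre_weights y w -> 0 <= w.2.
Proof. by case. Qed.

(** Beyond the prefix, every bit is chosen so that the signed value of [u n y'] is
nonnegative: such bits cost nothing. *)
Lemma fibre_weights_graft N (x : X) y' (t : R) : 0 <= t ->
  (forall n, (n < N)%N -> 1 <= (1 + t) * (1 + (-1) ^+ code x n * u n y')) ->
  exists x', (forall n, (n < N)%N -> code x' n = code x n) /\
    fibre_weights y' (x', t).
Proof.
move=> t0 H.
pose k' n := if (n < N)%N then code x n else u n y' < 0.
have k'P n : 1 <= (1 + t) * (1 + (-1) ^+ k' n * u n y').
  rewrite /k'; case: ifPn => [/H//|_]; have := sign_choice (u n y'); nra.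
have k'X : itinerary_set (k', y').
  move=> n /=; have := k'P n; nra.
exists (exist _ (k', y') (mem_set k'X)); split=> // n nN /=.
by rewrite /k' nN.
Qed.

Lemma fibre_weights_top y : exists x, fibre_weights y (x, 0).
Proof.
pose k n := u n y < 0.
have kX : itinerary_set (k, y).
  by move=> n /=; apply: le_trans (sign_choice _); rewrite oppr_le0.
exists (exist _ (k, y) (mem_set kX)); split => //= n.
by rewrite addr0 mul1r lerDl sign_choice.
Qed.

Definition fibre_idem y : idem R X :=
  weighted_idem compact_itineraries (@fibre_weights_ge0 y) (fibre_weights_top y).

Lemma supp_fibre_idem y : hausdorff_space Y ->
  supp (fibre_idem y) `<=` (fun x => base x) @^-1` [set y].
Proof.
move=> hY; apply: weighted_idem_supp => [|w [] //].
apply: preimage_closed; first by move=> x _; exact: base_continuous.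
exact: accessible_closed_set1 (hausdorff_accessible hY) y.
Qed.

(** A pair [(x, t)] of the fibre of [y] is matched with [(x', t + e)] in the fibre
of [y'], where [x'] keeps the first [N] bits of [x]: one [e] is lost on the
penalty and one on [phi]. *)
Lemma weighted_sup_close (phi : X -> R) B N e y y' :
  continuous phi -> (forall x, `|phi x| <= B) -> 0 < e ->
  (forall x x' : X, (forall n, (n < N)%N -> code x n = code x' n) ->
     `|phi x - phi x'| < e) ->
  (forall n, (n < N)%N ->
     `|u n y - u n y'| <= e / ((1 + 2 * B) * (1 + 2 * B + e))) ->
  weighted_sup (fibre_weights y) phi <=
  weighted_sup (fibre_weights y') phi + 2 * e.
Proof.
move=> cphi phiB e0 phiN uyy'.
have ub := weighted_sup_ub compact_itineraries (@fibre_weights_ge0 y') cphi.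
apply: (weighted_sup_le (fibre_weights_top y)) => -[x t] Wxt.
(* A penalty above [2 * B] gives less than [- B], whereas any pair of penalty
   [0] over [y'] gives at least [- B]. *)
have [tB|Bt] := leP t (2 * B); last first.
  have [x' /ub /=] := fibre_weights_top y'.
  have := phiB x; have := phiB x'; rewrite !ler_norml /=.
  move=> /andP[? ?] /andP[? ?].
  by lra.
have t0 : 0 <= t := fibre_weights_ge0 Wxt.
have te0 : 0 <= t + e by lra.
have [|x' [xx' /ub/=]] := @fibre_weights_graft N x y' _ te0; last first.
  have := phiN _ _ (fun n nN => esym (xx' n nN)).
  by rewrite /= ltr_norml => /andP[? ?]; lra.
move=> n nN; have [_ _ /(_ n) /=] := Wxt.
have := uyy' n nN; set D := (1 + 2 * B) * _.
set c := code x n; set a := u n y; set a' := u n y' => aa' H.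
have D0 : 0 < D by rewrite /D; nra.
have {}aa' : (-1) ^+ c * a - e / D <= (-1) ^+ c * a'.
  move: aa'; rewrite ler_norml => /andP[? ?].
  by case: c {H}; rewrite ?expr1 ?expr0; lra.
(* Since [t <= 2 * B], the bound [e / D] on the variation of [u n] is at most
   [e / ((1 + t) * (1 + t + e))], which the increase of [t] by [e] compensates. *)
have : (e / D) * ((1 + t) * (1 + t + e)) <= e.
  rewrite mulrAC ler_pdivrMr// ler_pM2l//; apply: ler_pM; lra.
move: aa' H; set q := e / D; set b := _ * a; set b' := _ * a' => bb' H qe.
have : (1 + t + e) * (1 + b - q) <= (1 + t + e) * (1 + b').
  by rewrite ler_pM2l; lra.
rewrite addrA; apply: le_trans.
rewrite -(@ler_pM2l _ (1 + t)); last by lra.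
nra.
Qed.

Lemma fibre_idem_continuous : continuous fibre_idem.
Proof.
move=> y U /nbhs_idemP [s [e [e0 sU]]].
suff H (phi : continuousType X R) : nbhs y [set y' |
    `|idem_eval (fibre_idem y) phi - idem_eval (fibre_idem y') phi| < e].
  apply: (@filterS _ (nbhs y) _ _ _ (fun y' => sU (fibre_idem y'))).
  elim: s {sU} => [|phi s IH]; first by apply: filterS filterT => y' _ phi.
  apply: filterS (filterI (H phi) IH) => y' [y'phi y's] psi.
  by rewrite inE => /orP[/eqP ->//|/y's].
have e40 : 0 < e / 4 by rewrite divr_gt0.
have cphi : continuous phi by exact: cts_fun.
have [B phiB] := compact_bounded_fun compact_itineraries cphi.
have [N phiN] := prefix_modulus compact_itineraries code_bit_continuous
  code_inj cphi e40.
have [x _] := fibre_weights_top y.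
have B0 : 0 <= B := le_trans (normr_ge0 _) (phiB x).
pose D := (1 + 2 * B) * (1 + 2 * B + e / 4).
have D0 : 0 < e / 4 / D by rewrite divr_gt0// /D; nra.
have : nbhs y [set y' | forall n, (n < N)%N -> `|u n y - u n y'| < e / 4 / D].
  elim: N {phiN} => [|N IH]; first by apply: filterS filterT => y' _.
  have := u_cont (nbhsx_ballx (u N y : R) _ D0) => HN.
  apply: filterS (filterI IH HN) => y' [y'n y'N] n.
  by rewrite ltnS leq_eqVlt => /orP[/eqP ->//|/y'n].
apply: filterS => y' yy'.
have h1 := weighted_sup_close cphi phiB e40 phiN (fun n nN => ltW (yy' n nN)).
have h2 : weighted_sup (fibre_weights y') phi <=
    weighted_sup (fibre_weights y) phi + 2 * (e / 4).
  by apply: weighted_sup_close phiN _ => // n nN; rewrite distrC ltW// yy'.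
rewrite /idem_eval /fibre_idem /weighted_idem /= set_valE /= ltr_norml.
by apply/andP; split; lra.
Qed.

End Construction.

Theorem theorem4p1 (R : realType) (Y : topologicalType)
    (Ycompact : compact [set: Y]) (Ymetrizable : metrizable R Y) :
  exists X : topologicalType,
    [/\ zero_dimensional X, compact [set: X], metrizable R X &
        exists2 f : X -> Y, continuous f &
        exists2 s : Y -> idem R X, continuous s &
        forall y : Y, supp (s y) `<=` f @^-1` [set y]].
Proof.
have [u [u_cont u_sep]] := separating_sequence Ycompact Ymetrizable.
have cX := compact_itineraries Ycompact u_cont.
have cb := @code_bit_continuous R Y u.
have ib := code_inj u_sep.
exists (set_type (itinerary_set u)); split=> //.
- exact: coded_zero_dimensional cb ib.
- exact: coded_metrizable cX cb ib.
exists (fun x => (set_val x).2); first exact: base_continuous.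
exists (fibre_idem Ycompact u_cont); first exact: fibre_idem_continuous.
move=> y; apply: supp_fibre_idem; exact: metrizable_hausdorff Ymetrizable.
Qed.
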